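(* Let $k$ be a field with $u(k)\leq 2$ which is not quadratically closed, with $\mathrm{char}(k)\neq 2$ and $|k|\geq 5$. Let $\overline{\epsilon}\in k^{\times}/k^{\times 2}$ and let $\mathscr{C}$ be a semisimple conjugacy class in $\mathrm{SL}_2(k)$. Then the following hold: (1) $\mathscr{C} U_{-1,\overline{\epsilon}}$ contains neither $I$ nor $-I$. (2) $\mathscr{C} U_{-1,\overline{\epsilon}}$ contains $\mathscr{C}$ if and only if $\mathrm{tr}(\mathscr{C})\neq 0$ or $-1\in k^{\times 2}$. (3) For a semisimple conjugacy class $\mathscr{C}'$ with $\mathscr{C}'\neq \mathscr{C}$, $\mathscr{C} U_{-1,\overline{\epsilon}}$ contains $\mathscr{C}'$ if and only if $\mathrm{tr}(\mathscr{C})\neq-\mathrm{tr}(\mathscr{C}')$, or at least one of $\mathscr{C}$ or $\mathscr{C}'$ is split semisimple. (4) For a unipotent conjugacy class $U_{\overline{\epsilon_1}}$, $\mathscr{C} U_{-1,\overline{\epsilon}}$ contains $U_{\overline{\epsilon_1}}$ if and only if $\overline{\mathrm{tr}(\mathscr{C})+2} =\overline{\epsilon \epsilon_1}$ in $k^{\times}/k^{\times 2}$. (5) For a negative unipotent conjugacy class $U_{-1,\overline{\epsilon_1}}$, $\mathscr{C} U_{-1,\overline{\epsilon}}$ contains $U_{-1,\overline{\epsilon_1}}$ if and only if $\overline{\mathrm{tr}(\mathscr{C})-2} =\overline{\epsilon \epsilon_1}$ in $k^{\times}/k^{\times 2}$.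
   Context: A field $k$ has $u(k)\leq 2$ if every quadratic form in $3$ variables over $k$ is isotropic. A field is quadratically closed if it admits no quadratic extension. $k^{\times 2}$ is the set of squares in $k^\times$, and $\bar\epsilon$ is the image of $\epsilon\in k^\times$ in $k^\times/k^{\times2}$. $U_{\overline{\epsilon}}$ denotes the $\mathrm{SL}_2(k)$-conjugacy class of $\begin{pmatrix}1&\epsilon\\0&1\end{pmatrix}$ and $U_{-1,\overline{\epsilon}}$ that of $\begin{pmatrix}-1&\epsilon\\0&-1\end{pmatrix}$; both depend only on $\overline{\epsilon}$. Semisimple classes are non-central; they are split if their elements are diagonalizable over $k$ and non-split otherwise. $\mathrm{tr}(\mathscr{C})$ is the common trace of elements of $\mathscr{C}$. $AB=\{xy:x\in A,y\in B\}$. *)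

(* Defs.v *)
From HB Require Import structures.
From mathcomp Require Import all_boot all_order all_algebra all_field.
From mathcomp Require Import classical_sets cardinality.
From mathcomp Require Import mpoly.

Set Implicit Arguments.
Unset Strict Implicit.
Unset Printing Implicit Defensive.

Import GRing.Theory.
Local Open Scope classical_set_scope.
Local Open Scope ring_scope.

Section FieldHypotheses.
Variable k : fieldType.

Definition isotropic n (q : {mpoly k[n]}) : Prop :=
  exists2 v : 'I_n -> k, (exists i, v i != 0) & q.@[v] = 0.

Definition u_le2 : Prop :=
  forall q : {mpoly k[3]}, q \is 2.-homog -> isotropic q.

Definition quadratically_closed : Prop :=
  forall L : fieldExtType k, \dim {: L} <> 2%N.

(* The subgroup of nonzero squares, and its cosets: the class of [a] in the
   quotient of the multiplicative group by it is represented by the set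
   [sqclass a], so equality of classes is equality of sets.  The junk value
   [sqclass 0 = [set 0]] is different from the class of any nonzero element. *)
Definition nzsquares : set k := [set s ^+ 2 | s in [set s | s != 0]].

Definition sqclass (a : k) : set k := [set a * t | t in nzsquares].

End FieldHypotheses.

Section SL2.
Variable k : fieldType.
Implicit Types (x g : 'M[k]_2) (A B C : set 'M[k]_2).

Definition mx2 (a b c d : k) : 'M[k]_2 :=
  \matrix_(i < 2, j < 2) nth 0 (nth [::] [:: [:: a; b]; [:: c; d]] i) j.

Definition SL2 : set 'M[k]_2 := [set x | \det x = 1].

Definition SL2_class x : set 'M[k]_2 := [set g * x * g^-1 | g in SL2].

Definition mulset A B : set 'M[k]_2 := [set x * y | x in A & y in B].

(* Diagonalizability over an algebraic closure is the same as over some finite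
   extension, and only the latter has a library type for an arbitrary [k]. *)
Definition semisimple x : Prop :=
  exists L : fieldExtType k, diagonalizable (map_mx (in_alg L) x).

Definition semisimple_class C : Prop :=
  exists x, [/\ SL2 x, semisimple x, ~~ is_scalar_mx x & C = SL2_class x].

Definition split_semisimple_class C : Prop :=
  semisimple_class C /\ forall x, C x -> diagonalizable x.

(* The common value of the trace on a conjugacy class (see [class_trE]). *)
Definition class_tr C : k := xget 0 [set \tr x | x in C].

Definition unip_class (e : k) : set 'M[k]_2 := SL2_class (mx2 1 e 0 1).

Definition neg_unip_class (e : k) : set 'M[k]_2 := SL2_class (mx2 (- 1) e 0 (- 1)).

Lemma SL2_unit x : SL2 x -> x \is a GRing.unit.
Proof. by move=> dx; change (x \in unitmx); rewrite unitmxE dx unitr1. Qed.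

Lemma class_trE x : class_tr (SL2_class x) = \tr x.
Proof.
rewrite /class_tr; case: xgetP => [t _ [_ [g gS <-] <-]|none].
  change (\tr (g *m x *m g^-1) = \tr x).
  rewrite mxtrace_mulC mulmxA.
  by change (\tr (g^-1 * g * x) = \tr x); rewrite mulVr ?SL2_unit // mul1r.
case: (none (\tr x)); exists x => //; exists 1; first exact: det1.
by rewrite invr1 mulr1 mul1r.
Qed.

Lemma SL2_class_conj x g : SL2 g -> SL2_class (g * x * g^-1) = SL2_class x.
Proof.
move=> dg; have gU := SL2_unit dg.
have dV : \det g^-1 = 1.
  by change (\det (invmx g) = 1); rewrite det_inv dg invr1.
apply/seteqP; split=> _ [h dh <-].
  exists (h * g); first by rewrite /SL2 /= det_mulmx dh dg mulr1.
  by rewrite invrM ?SL2_unit // !mulrA.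
exists (h * g^-1); first by rewrite /SL2 /= det_mulmx dh dV mulr1.
by rewrite invrM ?unitrV ?SL2_unit // invrK !mulrA mulrVK // mulrVK.
Qed.

Lemma SL2_mx2_diag s : s != 0 -> SL2 (mx2 s 0 0 s^-1).
Proof.
move=> s0; rewrite /SL2 /= det_trig; last first.
  by apply/is_trig_mxP => -[[|[|i]] hi] [[|[|j]] hj] //= _; rewrite mxE.
by rewrite !big_ord_recl big_ord0 !mxE /= mulr1 mulfV.
Qed.

Lemma conj_mx2 a e s : s != 0 ->
  mx2 s 0 0 s^-1 * mx2 a e 0 a * (mx2 s 0 0 s^-1)^-1 = mx2 a (e * s ^+ 2) 0 a.
Proof.
move=> s0; have sU : mx2 s 0 0 s^-1 \is a GRing.unit.
  exact/SL2_unit/SL2_mx2_diag.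
apply: (canLR (mulrK sU)); apply/matrixP => i j.
rewrite !mxE !big_ord_recl !big_ord0 !mxE.
case: i => [[|[|i]] hi] //; case: j => [[|[|j]] hj] //=;
  rewrite ?(mulr0, mul0r, addr0, add0r) //; first exact: mulrC.
  by rewrite expr2 -!mulrA mulfV // mulr1 mulrC.
exact: mulrC.
Qed.

Lemma sqclass_class a e e' : sqclass e = sqclass e' ->
  SL2_class (mx2 a e 0 a) = SL2_class (mx2 a e' 0 a).
Proof.
move=> ee'; have : sqclass e e.
  by exists 1; rewrite ?mulr1 //; exists 1; rewrite /= ?oner_neq0 // expr1n.
rewrite ee' => -[_ [s /= s0 <-] <-]; rewrite -conj_mx2 // SL2_class_conj //.
exact: SL2_mx2_diag.
Qed.

End SL2.

(* Main.v *)
(* A noncentral semisimple class is the set of all matrices of determinant 1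
   with a given trace t, t^2 <> 4: a binary quadratic form of nonzero
   discriminant represents 1 because u(k) <= 2, and applying this to
   v |-> det (v, x v) conjugates x inside SL_2 to a companion matrix.
   With u = (-1, eps; 0, -1), the trace of x u is - tr x + eps c, where c is the
   lower left entry of x; so the trace of the product prescribes c.  A nonzero c
   occurs in every class, c = 0 only in the split ones.  In the unipotent cases
   c is nonzero, and its square class decides which class is reached. *)
Require Import Defs.
From HB Require Import structures.
From mathcomp Require Import mpoly.
From mathcomp Require Import all_boot all_order all_algebra all_field.
From mathcomp Require Import ring.
From mathcomp Require Import classical_sets cardinality.

Set Implicit Arguments.
Unset Strict Implicit.

Import GRing.Theory.
Local Open Scope classical_set_scope.
Local Open Scope ring_scope.

(** * Two-by-two matrices and conjugacy under SL_2 *)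

Lemma mx2E (R : fieldType) (x : 'M[R]_2) :
  x = mx2 (x 0 0) (x 0 1) (x 1 0) (x 1 1).
Proof.
apply/matrixP => i j; rewrite mxE.
by case: i => [[|[|i]] hi] //; case: j => [[|[|j]] hj] //=;
  congr (x _ _); apply/val_inj.
Qed.

Lemma mx2P (R : fieldType) (x : 'M[R]_2) : exists a b c d, x = mx2 a b c d.
Proof. by rewrite (mx2E x); do 4!eexists. Qed.

Section Mx2.
Variable k : fieldType.
Implicit Types (a b c d e s t : k) (x y z g : 'M[k]_2) (C : set 'M[k]_2).

Lemma mx2_inj a b c d a' b' c' d' : mx2 a b c d = mx2 a' b' c' d' ->
  [/\ a = a', b = b', c = c' & d = d'].
Proof.
move=> /matrixP E.
by split; [have := E 0 0|have := E 0 1|have := E 1 0|have := E 1 1]; rewrite !mxE.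
Qed.

Lemma mul_mx2 a b c d a' b' c' d' : mx2 a b c d * mx2 a' b' c' d' =
  mx2 (a * a' + b * c') (a * b' + b * d') (c * a' + d * c') (c * b' + d * d').
Proof.
apply/matrixP => i j; rewrite !mxE !big_ord_recl !big_ord0 !mxE.
by case: i => [[|[|i]] hi] //; case: j => [[|[|j]] hj] //=; rewrite addr0.
Qed.

Lemma det_mx2 a b c d : \det (mx2 a b c d) = a * d - b * c.
Proof.
rewrite (expand_det_row _ 0) !big_ord_recl big_ord0 /cofactor !det_mx11 !mxE /=.
by rewrite expr0 expr1; ring.
Qed.

Lemma tr_mx2 a b c d : \tr (mx2 a b c d) = a + d.
Proof. by rewrite /mxtrace !big_ord_recl big_ord0 !mxE /= addr0. Qed.

Lemma scalar_mx2 a : mx2 a 0 0 a = a%:M.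
Proof.
apply/matrixP => i j; rewrite !mxE.
by case: i => [[|[|i]] hi] //; case: j => [[|[|j]] hj].
Qed.

Lemma SL2M x y : SL2 x -> SL2 y -> SL2 (x * y).
Proof. by rewrite /SL2 /= det_mulmx => -> ->; rewrite mulr1. Qed.

Lemma SL2V x : SL2 x -> SL2 x^-1.
Proof. by rewrite /SL2 /= => dx; rewrite [x^-1]/(invmx x) det_inv dx invr1. Qed.

(** Clearing the inverse turns conjugacy into polynomial identities between entries. *)
Lemma SL2_class_intertwine x y :
  SL2_class x y <-> exists2 g, SL2 g & g * x = y * g.
Proof.
split=> [[g dg <-]|[g dg e]]; exists g => //; first by rewrite mulrVK ?SL2_unit.
by rewrite e mulrK ?SL2_unit.
Qed.

Lemma SL2_class_refl x : SL2_class x x.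
Proof.
by apply/SL2_class_intertwine; exists 1; [exact: det1|rewrite mul1r mulr1].
Qed.

Lemma SL2_class_eq x y : SL2_class x y -> SL2_class y = SL2_class x.
Proof. by move=> [g dg <-]; rewrite SL2_class_conj. Qed.

Lemma SL2_class_tr x y : SL2_class x y -> \tr y = \tr x.
Proof. by move=> /SL2_class_eq e; rewrite -!class_trE e. Qed.

Lemma SL2_class_SL2 x y : SL2 x -> SL2_class x y -> SL2 y.
Proof. by move=> dx [g dg <-]; apply: SL2M (SL2V dg); apply: SL2M. Qed.

(** A product of classes is stable under conjugation, so it contains a class once it meets it; a
    simultaneous conjugation then fixes the second factor as [y]. *)
Lemma SL2_class_subset_mulset x y z :
  SL2_class z `<=` mulset (SL2_class x) (SL2_class y) <->
  exists2 w, SL2_class x w & SL2_class z (w * y).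
Proof.
split=> [/(_ z (SL2_class_refl z)) [w xw [_ [g dg <-] wz]]|[w xw zwy] v].
  exists (g^-1 * w * g).
    rewrite -(SL2_class_eq xw); exists g^-1; first exact: SL2V.
    by rewrite invrK.
  exists g^-1; first exact: SL2V.
  by rewrite -wz invrK !mulrA mulrVK ?SL2_unit.
rewrite -(SL2_class_eq zwy) => -[g dg <-].
exists (g * w * g^-1); first by rewrite -(SL2_class_eq xw); exists g.
exists (g * y * g^-1); first by exists g.
by rewrite !mulrA mulrVK ?SL2_unit.
Qed.

(* The lower left entry of the conjugate by g is -e g21^2. *)
Lemma SL2_class_transvection s e p q r v : s ^+ 2 = 1 -> e != 0 ->
  SL2 (mx2 p q r v) -> p + v = s + s -> r != 0 ->
  SL2_class (mx2 s e 0 s) (mx2 p q r v) <->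
  exists2 m, m != 0 & r = - (e * m ^+ 2).
Proof.
move=> s1 e0; rewrite /SL2 /= det_mx2 => det1 tr r0; split.
  move=> /SL2_class_intertwine [g]; have [a [b [c [d ->]]]] := mx2P g.
  rewrite /SL2 /= det_mx2 !mul_mx2 => dg /mx2_inj[_ _ E1 E2].
  have rE : r = - (e * c ^+ 2).
    (* The bottom row of the intertwining relation, combined with coefficients [d] and [- c],
       eliminates [v] and leaves [r] times the determinant of g. *)
    have -> : r = (r * a + v * c) * d - (r * b + v * d) * c
                + r * (1 - (a * d - b * c)) by ring.
    by rewrite dg -E1 -E2; ring.
  exists c => //; apply: contraNneq r0 => c0.
  by rewrite rE c0 expr0n mulr0 oppr0.
move=> [m m0 rE]; apply/SL2_class_intertwine.
(* The centralizer of the target allows a lower right entry 0; the determinant and the bottom row of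
   the relation then fix the upper row. *)
exists (mx2 ((s - p) / (e * m)) (- m^-1) m 0).
  by rewrite /SL2 /= det_mx2; field; rewrite e0 m0.
have vE : v = s + s - p by rewrite -tr; ring.
have qE : q = (s - p) ^+ 2 / (e * m ^+ 2).
  apply: (mulIf r0); move: det1; rewrite vE rE => det1.
  have -> : q * - (e * m ^+ 2) = (s ^+ 2 - 1) - (s - p) ^+ 2
            + (p * (s + s - p) - q * - (e * m ^+ 2) - 1) * -1 by ring.
  by rewrite det1 s1; field; rewrite e0 m0.
rewrite !mul_mx2; congr mx2; rewrite ?vE ?qE ?rE; field; rewrite ?m0 ?e0 //.
Qed.

End Mx2.

(** * Square classes *)

Section SquareClass.
Variable k : fieldType.
Implicit Types a b c e f : k.

Lemma sqclass_eqP a b :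
  sqclass a = sqclass b <-> exists2 m, m != 0 & a = b * m ^+ 2.
Proof.
split=> [ab|[m m0 ->]].
  have: sqclass a a.
    by exists 1; rewrite ?mulr1 //; exists 1; rewrite /= ?oner_neq0 ?expr1n.
  by rewrite ab => -[_ [m /= m0 <-] <-]; exists m.
apply/seteqP; split=> _ [_ [s /= s0 <-] <-].
  exists ((m * s) ^+ 2); first by exists (m * s); rewrite //= mulf_neq0.
  by ring.
exists ((s / m) ^+ 2); first by exists (s / m); rewrite //= mulf_neq0 ?invr_neq0.
by field.
Qed.

(** The form used for unipotent classes: [a / e] will be the lower left entry forced by the
    traces. *)
Lemma sqclass_mul_eqP a e f : e != 0 -> f != 0 ->
  sqclass a = sqclass (e * f) <-> exists2 m, m != 0 & a / e = f * m ^+ 2.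
Proof.
move=> e0 f0; rewrite sqclass_eqP; split=> -[m m0 E].
  by exists m => //; rewrite E; field.
by exists m => //; rewrite -[LHS](divfK e0) E; ring.
Qed.

End SquareClass.

(** * Consequences of u(k) <= 2: the trace determines the class *)

Section ULe2.
Variable k : fieldType.
Hypothesis hu : u_le2 k.
Implicit Types (a b c d e s t : k) (x y z g : 'M[k]_2) (C : set 'M[k]_2).

(** Subtracting a third square gives an isotropic ternary form. If its zero has nonzero last
    coordinate, rescale; otherwise the binary form is isotropic and nondegenerate, hence
    universal. *)
Lemma binary_form_represents1 a b c : b ^+ 2 - 4%:R * a * c != 0 ->
  exists p q, a * p ^+ 2 + b * p * q + c * q ^+ 2 = 1.
Proof.
move=> disc.
pose X i : {mpoly k[3]} := mpolyX k (mnm1 (inord i)).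
pose Q := a *: (X 0%N * X 0%N) + b *: (X 0%N * X 1%N) + c *: (X 1%N * X 1%N)
          - X 2%N * X 2%N.
have XX i j : X i * X j \is 2.-homog.
  by apply: (@dhomogM _ _ _ 1 _ 1); rewrite dhomogX /= mdeg1.
have /hu [v [i vi] Qv] : Q \is 2.-homog.
  by apply: rpredB => //; do !apply: rpredD; do ?apply: rpredZ.
set p := v (inord 0); set q := v (inord 1); set r := v (inord 2).
have {}Qv : a * p ^+ 2 + b * p * q + c * q ^+ 2 = r ^+ 2.
  apply/eqP; rewrite -subr_eq0 -Qv /Q !(mevalB, mevalD, mevalZ, mevalM).
  by rewrite !mevalXU -/p -/q -/r; apply/eqP; ring.
have [r0|r0] := eqVneq r 0; last first.
  exists (p / r), (q / r); rewrite -[RHS](divff (expf_neq0 2 r0)) -{1}Qv.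
  by field.
(* On an isotropic vector v, Q (w + s v) is affine in s, with slope B(v, w). *)
pose dp := 2%:R * a * p + b * q; pose dq := b * p + 2%:R * c * q.
rewrite r0 (expr2 0) mulr0 in Qv.
have [dp0|dp0] := eqVneq dp 0; last first.
  pose s := (1 - a) / dp; exists (1 + s * p), (s * q).
  (* The factor 0 stands for the value of the form at v and is rewritten into it below. *)
  have s1 : a + s * dp + s ^+ 2 * 0 = 1.
    by rewrite /s divfK // subrKC mulr0 addr0.
  by rewrite -[RHS]s1 -Qv /dp; ring.
have [dq0|dq0] := eqVneq dq 0; last first.
  pose s := (1 - c) / dq; exists (s * p), (1 + s * q).
  have s1 : c + s * dq + s ^+ 2 * 0 = 1.
    by rewrite /s divfK // subrKC mulr0 addr0.
  by rewrite -[RHS]s1 -Qv /dq; ring.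
(* Both partial derivatives vanish at v, and their linear system has determinant minus the
   discriminant, so p = q = 0. *)
have p0 : p = 0.
  apply: (mulfI disc); rewrite mulr0.
  have -> : (b ^+ 2 - 4%:R * a * c) * p = b * dq - 2%:R * c * dp.
    by rewrite /dq /dp; ring.
  by rewrite dp0 dq0 !mulr0 subr0.
have q0 : q = 0.
  apply: (mulfI disc); rewrite mulr0.
  have -> : (b ^+ 2 - 4%:R * a * c) * q = b * dp - 2%:R * a * dq.
    by rewrite /dq /dp; ring.
  by rewrite dp0 dq0 !mulr0 subr0.
case/eqP: vi; rewrite -[i]inord_val.
by case: i => [[|[|[|i]]] hi] //=.
Qed.

Lemma SL2_class_trace x : SL2 x -> \tr x ^+ 2 != 4%:R ->
  SL2_class x = [set y | SL2 y /\ \tr y = \tr x].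
Proof.
have companion y : SL2 y -> \tr y ^+ 2 != 4%:R ->
    SL2_class y = SL2_class (mx2 0 (-1) 1 (\tr y)).
  have [a [b [c [d ->]]]] := mx2P y; rewrite /SL2 /= det_mx2 tr_mx2 => dy t4.
  (* This form is det (v, y v) at v = (p, q); its discriminant is tr^2 - 4 det. *)
  have [|p [q pq]] := @binary_form_represents1 c (d - a) (- b).
    have -> : (d - a) ^+ 2 - 4%:R * c * - b
              = (a + d) ^+ 2 - 4%:R * (a * d - b * c) by ring.
    by rewrite dy mulr1 subr_eq0.
  apply: SL2_class_eq; apply/SL2_class_intertwine.
  (* The columns are v and y v; the relation to check is Cayley-Hamilton, y (y v) = tr(y) y v -
     v. *)
  exists (mx2 p (a * p + b * q) q (c * p + d * q)).
    by rewrite /SL2 /= det_mx2 -pq; ring.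
  have E u : - u + (a * d - b * c) * u = 0 by rewrite dy mul1r addNr.
  rewrite !mul_mx2; congr mx2; rewrite ?mulr0 ?mulr1 ?add0r //; apply: subr0_eq.
    by rewrite -[RHS](E p); ring.
  by rewrite -[RHS](E q); ring.
move=> dx t4; apply/seteqP; split=> [y xy|y [dy ty]].
  by split; [exact: SL2_class_SL2 xy|exact: SL2_class_tr xy].
by rewrite companion // -ty -companion ?ty //; exact: SL2_class_refl.
Qed.

End ULe2.

(** * Eigenvalues of diagonalizable matrices *)

Section Diagonalizable.
Variable k : fieldType.
Implicit Types (a b c d e s t : k) (x y z : 'M[k]_2).

Lemma diagonalizable_mx2 x : diagonalizable x ->
  exists2 P, P \in unitmx & exists a d, P *m x *m invmx P = mx2 a 0 0 d.
Proof.
move=> [P Pu PD]; exists P => //; set D := P *m x *m invmx P.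
exists (D 0 0), (D 1 1); rewrite {1}(mx2E D).
by congr mx2; exact: (similar_diagP _ Pu PD).
Qed.

(** The equation says that [a] is a root in k of the characteristic polynomial; a diagonal entry of
    a diagonal form is one. *)
Lemma diagonalizable_eigenvalue2 x :
  diagonalizable x -> exists a, a * (\tr x - a) = \det x.
Proof.
move=> /diagonalizable_mx2 [P Pu [a [d E]]]; exists a.
have tE : \tr x = \tr (P *m x *m invmx P).
  by rewrite [RHS]mxtrace_mulC mulmxA mulVmx // mul1mx.
have -> : \det x = \det (P *m x *m invmx P).
  by rewrite !det_mulmx det_inv mulrAC mulfV ?mul1r // -unitfE -unitmxE.
by rewrite tE E tr_mx2 det_mx2 mulr0 subr0 addrAC subrr add0r.
Qed.

Lemma diagonalizable_double_eigenvalue x s :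
  diagonalizable x -> \det x = s ^+ 2 -> \tr x = s + s -> x = s%:M.
Proof.
move=> /diagonalizable_mx2 [P Pu [a [d E]]] dx tx.
have xE : x = invmx P *m mx2 a 0 0 d *m P.
  by rewrite -E !mulmxA mulVmx // mul1mx mulmxKV.
have dE : a * d = s ^+ 2.
  rewrite -dx -[LHS]subr0 -(mulr0 0) -(det_mx2 a 0 0) -E !det_mulmx det_inv mulrAC.
  by rewrite mulfV ?mul1r // -unitfE -unitmxE.
have tE : a + d = s + s.
  by rewrite -tx -(tr_mx2 a 0 0) -E mxtrace_mulC mulmxA mulVmx // mul1mx.
have d1 : d = s + s - a by rewrite -tE addrAC subrr add0r.
(* Here (a - s)^2 = s^2 - a d = 0. *)
have a1 : a = s.
  apply/eqP; rewrite -subr_eq0 -sqrf_eq0; apply/eqP.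
  by rewrite -[RHS](subrr (s ^+ 2)) -{2}dE d1; ring.
rewrite xE d1 a1 addrK scalar_mx2 mul_mx_scalar -scalemxAl mulVmx //.
exact: scalemx1.
Qed.

End Diagonalizable.

(** * Products with a negative unipotent class *)

Section ProductClass.
Variable k : fieldType.
Implicit Types (a b c d e s t : k) (x y z : 'M[k]_2).

Lemma sqr_eq4 t : t ^+ 2 = 4%:R -> exists2 s, s ^+ 2 = 1 & t = s + s.
Proof.
move=> t4; have /eqP : (t - 2%:R) * (t + 2%:R) = 0.
  by rewrite -[RHS](subrr (4%:R : k)) -{1}t4; ring.
rewrite mulf_eq0 => /orP[] /eqP h; [exists 1|exists (- 1)]; try by ring.
  by apply: subr0_eq; rewrite -h; ring.
by apply: subr0_eq; rewrite -h; ring.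
Qed.

(** With trace 2 or -2 there is a double eigenvalue, so over L the matrix is scalar, and this
    descends to k. *)
Lemma semisimple_tr_neq2 x :
  SL2 x -> semisimple x -> ~~ is_scalar_mx x -> \tr x ^+ 2 != 4%:R.
Proof.
move=> dx [L ssx]; apply: contraNneq => /sqr_eq4 [s s1 tx].
apply/is_scalar_mxP; exists s.
apply: (@map_mx_inj _ _ (in_alg L)); rewrite map_scalar_mx.
apply: diagonalizable_double_eigenvalue ssx _ _.
  by rewrite det_map_mx dx -rmorphXn s1.
by rewrite trace_map_mx tx rmorphD.
Qed.

Hypothesis hu : u_le2 k.

(** Given a root [a], the diagonal matrix with entries [a] and [\tr x - a] has the trace of [x],
    hence lies in its class. *)
Lemma split_SL2_class x : SL2 x -> \tr x ^+ 2 != 4%:R ->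
  (exists a, a * (\tr x - a) = 1) <->
  forall y, SL2_class x y -> diagonalizable y.
Proof.
move=> dx t4; split=> [[a a1] y|xD]; last first.
  by rewrite -dx; exact/diagonalizable_eigenvalue2/xD/SL2_class_refl.
have : SL2_class x (mx2 a 0 0 (\tr x - a)).
  by rewrite SL2_class_trace // /SL2 /= det_mx2 tr_mx2 mulr0 subr0 subrKC.
move=> /SL2_class_eq <- /SL2_class_eq yx.
have [g dg gy] : SL2_class y (mx2 a 0 0 (\tr x - a)).
  by rewrite yx; exact: SL2_class_refl.
have gU : g \in unitmx by exact: SL2_unit.
exists g => //; apply/(similar_diagP _ gU) => i j.
rewrite [g *m y *m invmx g]gy mxE.
by case: i => [[|[|i]] hi] //; case: j => [[|[|j]] hj].
Qed.

(** An entry c = 0 makes the matrix triangular, with eigenvalues in k. Conversely, since the trace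
    determines the class, one matrix of determinant 1 and the right trace suffices in each case. *)
Lemma lower_left_SL2_class x c : SL2 x -> \tr x ^+ 2 != 4%:R ->
  (exists a b d, SL2_class x (mx2 a b c d)) <->
  c <> 0 \/ exists a, a * (\tr x - a) = 1.
Proof.
move=> dx t4; rewrite SL2_class_trace //; split.
  move=> [a [b [d []]]]; rewrite /SL2 /= det_mx2 tr_mx2 => dy <-.
  have [c0|/eqP] := eqVneq c 0; [right; exists a|by left].
  by rewrite -dy c0; ring.
move=> [/eqP c0|[a a1]].
  exists 0, (- c^-1), (\tr x); rewrite /SL2 /= det_mx2 tr_mx2 add0r.
  by split=> //; field.
exists a, 0, (\tr x - a); rewrite /SL2 /= det_mx2 tr_mx2 subrKC a1.
by rewrite mul0r subr0.
Qed.

Variables (eps : k) (eps0 : eps != 0) (x : 'M[k]_2).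
Hypotheses (dx : SL2 x) (tx : \tr x ^+ 2 != 4%:R).

Let CU := mulset (SL2_class x) (neg_unip_class eps).

Lemma SL2_class_subset_neg_unip z :
  SL2_class z `<=` CU <->
  exists a b c d, SL2_class x (mx2 a b c d) /\
    SL2_class z (mx2 (- a) (a * eps - b) (- c) (c * eps - d)).
Proof.
have E a b c d : mx2 a b c d * mx2 (- 1) eps 0 (- 1) =
    mx2 (- a) (a * eps - b) (- c) (c * eps - d).
  by rewrite mul_mx2 !mulr0 !mulrN1 !addr0.
rewrite SL2_class_subset_mulset; split=> [[w]|[a [b [c [d [xw zw]]]]]].
  have [a [b [c [d ->]]]] := mx2P w; rewrite E => xw zw.
  by exists a, b, c, d.
by exists (mx2 a b c d); rewrite ?E.
Qed.

Lemma det_mul_neg_unip a b c d : SL2_class x (mx2 a b c d) ->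
  SL2 (mx2 (- a) (a * eps - b) (- c) (c * eps - d)).
Proof.
by move=> /(SL2_class_SL2 dx); rewrite /SL2 /= !det_mx2 => <-; ring.
Qed.

(** The trace of the product forces c = (tr x + tr z) / eps and already determines the class of [z];
    it remains to ask whether this c occurs in the class of [x]. *)
Lemma SL2_class_semisimple_subset z : SL2 z -> \tr z ^+ 2 != 4%:R ->
  SL2_class z `<=` CU <->
  \tr x + \tr z <> 0 \/ exists a, a * (\tr x - a) = 1.
Proof.
move=> dz tz; rewrite SL2_class_subset_neg_unip.
have c0 : (\tr x + \tr z) / eps <> 0 <-> \tr x + \tr z <> 0.
  by split=> /eqP h; apply/eqP; move: h; rewrite mulf_eq0 invr_eq0 (negPf eps0) orbF.
rewrite -c0 -(lower_left_SL2_class _ dx tx); split=> [[a [b [c [d [xw zw]]]]]|].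
  exists a, b, d; suff -> : (\tr x + \tr z) / eps = c by [].
  rewrite -(SL2_class_tr xw) -(SL2_class_tr zw) !tr_mx2.
  by field.
move=> [a [b [d xw]]]; exists a, b, ((\tr x + \tr z) / eps), d; split=> //.
rewrite [SL2_class z]SL2_class_trace //; split; first exact: det_mul_neg_unip.
by move: (SL2_class_tr xw); rewrite !tr_mx2 => <-; field.
Qed.

(** Both signs at once: c = (tr x + 2 s) / eps is nonzero because tr x is not -2 s, and the product,
    with lower left entry -c, lies in the given class exactly when c is [e] times a nonzero
    square. *)
Lemma SL2_class_unip_subset s e : s ^+ 2 = 1 -> e != 0 ->
  SL2_class (mx2 s e 0 s) `<=` CU <->
  sqclass (\tr x + s + s) = sqclass (eps * e).
Proof.
move=> s1 e0; rewrite SL2_class_subset_neg_unip sqclass_mul_eqP //.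
have t0 : \tr x + s + s != 0.
  apply: contraNneq tx => t0; apply/eqP.
  have -> : \tr x = - (s + s) by apply: subr0_eq; rewrite -t0; ring.
  by transitivity (4%:R * s ^+ 2); [ring|rewrite s1 mulr1].
have c0 : (\tr x + s + s) / eps != 0 by rewrite mulf_neq0 ?invr_eq0.
split=> [[a [b [c [d [xw zw]]]]]|[m m0 cE]].
  have cE : c = (\tr x + s + s) / eps.
    have := SL2_class_tr zw; rewrite -(SL2_class_tr xw) !tr_mx2 -addrA => <-.
    by field.
  have := zw; rewrite SL2_class_transvection //.
  - by rewrite cE => -[m m0 /oppr_inj]; exists m.
  - exact: det_mul_neg_unip.
  - by have := SL2_class_tr zw; rewrite !tr_mx2.
  - by rewrite oppr_eq0 cE.
have [a [b [d xw]]] : exists a b d,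
    SL2_class x (mx2 a b ((\tr x + s + s) / eps) d).
  by apply/lower_left_SL2_class => //; left; exact/eqP.
exists a, b, ((\tr x + s + s) / eps), d; split=> //.
apply/SL2_class_transvection; rewrite ?oppr_eq0 //.
- exact: det_mul_neg_unip.
- by rewrite -(SL2_class_tr xw) tr_mx2; field.
- by exists m; rewrite // cE.
Qed.

(** A scalar product forces c = 0 and a = d = -s, so tr x = -2 s, which is excluded. *)
Lemma neg_unip_product_nonscalar s : s ^+ 2 = 1 -> ~ CU s%:M.
Proof.
move=> s1 Cs; have : SL2_class s%:M `<=` CU.
  move=> _ [g dg <-].
  by rewrite [g * _]mul_mx_scalar -scalerAl mulrV ?SL2_unit // [_ *: _]scalemx1.
move=> /SL2_class_subset_neg_unip [a [b [c [d [xw [g dg]]]]]].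
rewrite [g * _]mul_mx_scalar -scalerAl mulrV ?SL2_unit // [_ *: _]scalemx1.
rewrite -scalar_mx2 => /mx2_inj[sa _ c0 sd]; case/eqP: tx.
have {}c0 : c = 0 by rewrite -[c]opprK -c0 oppr0.
rewrite -(SL2_class_tr xw) tr_mx2.
have -> : a = - s by rewrite sa opprK.
have -> : d = - s by rewrite sd c0 mul0r sub0r opprK.
by transitivity (4%:R * s ^+ 2); [ring|rewrite s1 mulr1].
Qed.

End ProductClass.

(** * Assembling the five assertions *)

Unset Implicit Arguments.

Theorem proposition3p22 (k : fieldType)
    (hu : u_le2 k) (hq : ~ quadratically_closed k)
    (hchar : 2%N \notin [pchar k]) (hcard : (`I_5 #<= [set: k])%card)
    (eps : k) (heps : eps != 0)
    (C : set 'M[k]_2) (hC : semisimple_class C) :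
  let CU := mulset C (neg_unip_class eps) in
  [/\ ~ CU 1 /\ ~ CU (- 1),
      C `<=` CU <-> (class_tr C <> 0 \/ nzsquares (- 1 : k)),
      forall C' : set 'M[k]_2, semisimple_class C' -> C' <> C ->
        (C' `<=` CU <->
          [\/ class_tr C <> - class_tr C',
              split_semisimple_class C | split_semisimple_class C']),
      forall eps1 : k, eps1 != 0 ->
        (unip_class eps1 `<=` CU <->
          sqclass (class_tr C + 2%:R) = sqclass (eps * eps1)) &
      forall eps1 : k, eps1 != 0 ->
        (neg_unip_class eps1 `<=` CU <->
          sqclass (class_tr C - 2%:R) = sqclass (eps * eps1))].
Proof.
have [x [dx ssx nsx ->]] := hC => CU; rewrite {}/CU.
have tx := semisimple_tr_neq2 dx ssx nsx.
rewrite class_trE; split.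
- have nonscalar := neg_unip_product_nonscalar (eps := eps) tx.
  split; first by have := nonscalar 1 (expr1n _ _).
  by have := nonscalar (- 1); rewrite sqrrN expr1n raddfN; apply.
(* The case z = x: as 2 is invertible, 2 tr x vanishes only with tr x, and at trace 0 the root
   condition reads -a^2 = 1. *)
- rewrite SL2_class_semisimple_subset //.
  have two0 : 2%:R != 0 :> k by move: hchar; rewrite inE.
  have [t0|t0] := eqVneq (\tr x) 0; last first.
    split=> _; left; first exact/eqP.
    by apply/eqP; rewrite -mulr2n -mulr_natl mulf_neq0.
  rewrite t0 addr0; split=> [[//|[a a1]]|[//|[a _ a1]]]; right.
    rewrite sub0r mulrN -expr2 in a1; exists a; last by rewrite -a1 opprK.
    by apply/eqP => a0; move/eqP: a1; rewrite a0 expr0n oppr0 eq_sym oner_eq0.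
  by exists a; rewrite sub0r mulrN -expr2 a1 opprK.
- move=> C' hC' _; have [y [dy ssy nsy C'E]] := hC'.
  have ty := semisimple_tr_neq2 dy ssy nsy.
  rewrite C'E class_trE SL2_class_semisimple_subset //.
  have splitE (z : 'M[k]_2) : SL2 z -> \tr z ^+ 2 != 4%:R -> semisimple z ->
      ~~ is_scalar_mx z ->
      split_semisimple_class (SL2_class z) <-> exists a, a * (\tr z - a) = 1.
    move=> dz tz ssz nsz; rewrite split_SL2_class //.
    by split=> [[]//|?]; split=> //; exists z.
  have sx := splitE x dx tx ssx nsx; have sy := splitE y dy ty ssy nsy.
  have [txy|txy] := eqVneq (\tr x) (- \tr y); last first.
    split=> _; first exact/Or31/eqP.
    by left; apply/eqP; rewrite addr_eq0.
  rewrite txy addNr in sx *; split=> [[//|/sx h]|[//|/sx h|/sy [a a1]]].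
  - exact: Or32.
  - by right.
  (* For opposite traces the roots are opposite, so the two classes split together. *)
  - by right; exists (- a); rewrite -a1; ring.
- move=> e e0; rewrite [unip_class e]/(SL2_class _) SL2_class_unip_subset ?expr1n //.
  by rewrite -addrA.
- move=> e e0; rewrite [neg_unip_class e]/(SL2_class _) SL2_class_unip_subset //.
    by rewrite -addrA -opprD.
  by rewrite sqrrN expr1n.
Qed.
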